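(* Let $\mathcal{C}$ be a cartesian monoidal category and let $(p,g,T)$ be a tagged vwb-lens from $V$ to $S$ in $\mathcal{C}$. If $T$ is first-last-depending, i.e. $T(T(s,v,v'),v',v'')=T(s,v,v'')$, then the induced lens $L((p,g,T))=(P,g)$, where $P(s,v)=p(T(s,g(s),v),v)$, satisfies the putput law: $P(P(s,v_1),v_2)=P(s,v_2)$.
   Context: Let $\mathcal{C}$ be a cartesian monoidal category (monoidal product $\otimes=\times$ the categorical product, unit terminal). Equations between morphisms are written with generalized elements (variables), as is standard in a category with finite products. A lens from $V$ to $S$ is a pair of morphisms $(p,g)$ with $p : S\times V\to S$ and $g : S\to V$. The lens laws are putput: $p(p(s,v_1),v_2)=p(s,v_2)$; putget: $g(p(s,v))=v$; getput: $p(s,g(s))=s$. A lens is very-well-behaved (vwb) if it satisfies all three. A tagged vwb-lens from $V$ to $S$ is a triple $(p,g,T)$ where $(p,g)$ is a vwb-lens from $V$ to $S$ and $T : S\times V\times V\to S$ satisfies $p(T(s,v_1,v_2),v_3)=T(p(s,v_3),v_1,v_2)$ and $g(T(s,v_1,v_2))=g(s)$. The tag $T$ is first-last-depending if $T(T(s,v,v'),v',v'')=T(s,v,v'')$. The induced lens is $L((p,g,T)):=(P,g)$ with $P(s,v):=p(T(s,g(s),v),v)$. *)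

(* Defs.v *)
Set Implicit Arguments.
Unset Strict Implicit.
Unset Printing Implicit Defensive.

Record category := Category {
  ob :> Type;
  hom : ob -> ob -> Type;
  idm : forall X, hom X X;
  comp : forall X Y Z, hom Y Z -> hom X Y -> hom X Z;
  comp_idl : forall X Y (f : hom X Y), comp (idm Y) f = f;
  comp_idr : forall X Y (f : hom X Y), comp f (idm X) = f;
  comp_assoc : forall W X Y Z (h : hom Y Z) (g : hom X Y) (f : hom W X),
    comp h (comp g f) = comp (comp h g) f
}.
Arguments hom {c} X Y.
Arguments idm {c} X.
Arguments comp {c X Y Z} g f.

(* The monoidal structure is the one induced by the chosen finite products, so
   its coherence isomorphisms carry no data beyond the universal properties. *)
Record cartesian_category := CartesianCategory {
  ccat :> category;
  unit_ob : ccat;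
  bang : forall X : ccat, hom X unit_ob;
  bang_unique : forall (X : ccat) (f : hom X unit_ob), f = bang X;
  prod_ob : ccat -> ccat -> ccat;
  proj1m : forall A B, hom (prod_ob A B) A;
  proj2m : forall A B, hom (prod_ob A B) B;
  pairm : forall X A B, hom X A -> hom X B -> hom X (prod_ob A B);
  proj1_pairm : forall X A B (a : hom X A) (b : hom X B),
    comp (proj1m A B) (pairm a b) = a;
  proj2_pairm : forall X A B (a : hom X A) (b : hom X B),
    comp (proj2m A B) (pairm a b) = b;
  pairm_unique : forall X A B (h : hom X (prod_ob A B)),
    h = pairm (comp (proj1m A B) h) (comp (proj2m A B) h)
}.
Arguments unit_ob {c}.
Arguments bang {c} X.
Arguments prod_ob {c} A B.
Arguments proj1m {c} A B.
Arguments proj2m {c} A B.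
Arguments pairm {c X A B} a b.

Declare Scope cart_scope.
Delimit Scope cart_scope with cart.
Notation "A * B" := (prod_ob A B) : cart_scope.
Local Open Scope cart_scope.

(* A morphism [x : hom X A] is a generalized element of [A] at stage [X]; the
   value [f(x, y, ...)] is the composite of [f] with the tuple of arguments. *)
Definition app1 (C : cartesian_category) (X A D : C)
    (f : hom A D) (x : hom X A) : hom X D :=
  comp f x.

Definition app2 (C : cartesian_category) (X A B D : C)
    (f : hom (A * B) D) (x : hom X A) (y : hom X B) : hom X D :=
  comp f (pairm x y).

Definition app3 (C : cartesian_category) (X A A' B D : C)
    (f : hom (A * A' * B) D) (x : hom X A) (y : hom X A') (z : hom X B) :
    hom X D :=
  comp f (pairm (pairm x y) z).

Record lens (C : cartesian_category) (V S : C) := Lens {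
  put : hom (S * V) S;
  get : hom S V
}.

(* An equation in variables is quantified over generalized elements at every
   stage [X]; taking the projections out of the product of the variables' types
   recovers the corresponding equation between morphisms. *)
Definition putput (C : cartesian_category) (V S : C) (l : lens V S) : Prop :=
  forall (X : C) (s : hom X S) (v1 v2 : hom X V),
    app2 (put l) (app2 (put l) s v1) v2 = app2 (put l) s v2.

Definition putget (C : cartesian_category) (V S : C) (l : lens V S) : Prop :=
  forall (X : C) (s : hom X S) (v : hom X V),
    app1 (get l) (app2 (put l) s v) = v.

Definition getput (C : cartesian_category) (V S : C) (l : lens V S) : Prop :=
  forall (X : C) (s : hom X S),
    app2 (put l) s (app1 (get l) s) = s.

Definition very_well_behaved (C : cartesian_category) (V S : C)
    (l : lens V S) : Prop :=
  putput l /\ putget l /\ getput l.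

Record tagged_vwb_lens (C : cartesian_category) (V S : C) := TaggedVwbLens {
  base_lens : lens V S;
  tag : hom (S * V * V) S;
  base_lens_vwb : very_well_behaved base_lens;
  put_tag : forall (X : C) (s : hom X S) (v1 v2 v3 : hom X V),
    app2 (put base_lens) (app3 tag s v1 v2) v3 =
    app3 tag (app2 (put base_lens) s v3) v1 v2;
  get_tag : forall (X : C) (s : hom X S) (v1 v2 : hom X V),
    app1 (get base_lens) (app3 tag s v1 v2) = app1 (get base_lens) s
}.

Definition first_last_depending (C : cartesian_category) (V S : C)
    (T : hom (S * V * V) S) : Prop :=
  forall (X : C) (s : hom X S) (v v' v'' : hom X V),
    app3 T (app3 T s v v') v' v'' = app3 T s v v''.

(* [P(s, v) := p(T(s, g(s), v), v)], with [s] and [v] the two projections out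
   of [S * V]. *)
Definition induced_lens (C : cartesian_category) (V S : C)
    (l : tagged_vwb_lens V S) : lens V S :=
  let p := put (base_lens l) in
  let g := get (base_lens l) in
  let s := proj1m S V in
  let v := proj2m S V in
  Lens (app2 p (app3 (tag l) s (app1 g s) v) v) g.

(* Main.v *)
Require Import Defs.

(** Commuting the tag past the put turns the induced put into
    P(s, v) = T(p(s, v), g(s), v): overwrite the view, then tag the change from
    the old view g(s) to the new one v. Two successive updates therefore carry
    the tags (g(s), v1) and, since the view after the first update is v1 by
    putget, (v1, v2). The second tag starts where the first one ends, so the
    first-last-depending law fuses them into (g(s), v2), while the two base puts
    collapse by putput. What remains is a single update by v2.

    This computation takes place on generalized elements, whereas the induced
    put is a morphism built from the projections of S * V. Passing from one to
    the other is the naturality of pairing under precomposition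
    ([pairm_comp]). *)

Lemma pairm_comp (C : cartesian_category) (W X A B : C)
    (a : hom X A) (b : hom X B) (h : hom W X) :
  comp (pairm a b) h = pairm (comp a h) (comp b h).
Proof.
  rewrite (pairm_unique (comp (pairm a b) h)).
  now rewrite !comp_assoc, proj1_pairm, proj2_pairm.
Qed.

Lemma put_induced_lens (C : cartesian_category) (V S : C)
    (l : tagged_vwb_lens V S) (X : C) (s : hom X S) (v : hom X V) :
  app2 (put (induced_lens l)) s v =
  app2 (put (base_lens l))
    (app3 (tag l) s (app1 (get (base_lens l)) s) v) v.
Proof.
  unfold induced_lens, app1, app2, app3; simpl.
  rewrite <- !comp_assoc, !pairm_comp, <- !comp_assoc, !pairm_comp.
  now rewrite <- !comp_assoc, !proj1_pairm, !proj2_pairm.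
Qed.

(** With the tag outermost, two successive updates put one tag directly over
    another, which is the shape that the first-last-depending law rewrites. *)
Lemma put_induced_lens_tag (C : cartesian_category) (V S : C)
    (l : tagged_vwb_lens V S) (X : C) (s : hom X S) (v : hom X V) :
  app2 (put (induced_lens l)) s v =
  app3 (tag l) (app2 (put (base_lens l)) s v)
    (app1 (get (base_lens l)) s) v.
Proof. now rewrite put_induced_lens, put_tag. Qed.

Theorem proposition7 (C : cartesian_category) (V S : C)
    (l : tagged_vwb_lens V S) (hT : first_last_depending (tag l)) :
  putput (induced_lens l).
Proof.
  intros X s v1 v2.
  destruct (base_lens_vwb l) as [Hputput [Hputget _]].
  rewrite !put_induced_lens_tag.
  (* The intermediate view is v1, so the second tag starts at v1. *)
  rewrite get_tag, Hputget.
  (* The base put is moved under the first tag, which makes the tags adjacent. *)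
  now rewrite put_tag, Hputput, hT.
Qed.
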